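(* Let $n\ge1$. The map $(\mathrm{vlk}_{ij}-\mathrm{vlk}_{ji})_{1\le i<j\le n}$ with values in $\mathbb{Z}^{\frac{n(n-1)}{2}}$ w-classifies $\mathrm{CC}$; that is, it is invariant under welded Reidemeister moves and under $\mathrm{CC}$, and the induced map $\mathrm{wSL}_n^{\mathrm{CC}}\to\mathbb{Z}^{\frac{n(n-1)}{2}}$ is an isomorphism of monoids.
   Context: A Gauss diagram on $n$ strands is a finite set of signed arrows (tail, head, sign $\pm1$), all endpoints being distinct points of $n$ ordered oriented intervals (strands), up to orientation-preserving homeomorphisms of the intervals; Gauss diagrams form a monoid under stacking (concatenation of corresponding strands). Endpoints are adjacent if they lie on the same strand with no other endpoint between them. Moves are used in both directions; portions of strands below are disjoint, contain only the mentioned endpoints, and may lie on any strands with any orientation. Welded Reidemeister moves: (R1) insert or delete an arrow of any sign with adjacent endpoints; (R2) insert or delete two arrows with opposite signs whose tails are adjacent on one portion and whose heads are adjacent on another; (R3) given portions $s_1,s_2,s_3$ containing exactly the endpoints of arrows $s_1\to s_2$, $s_2\to s_3$, $s_1\to s_3$ with signs $\varepsilon_{12},\varepsilon_{23},\varepsilon_{13}$, exchange the two endpoints on each portion, provided $\varepsilon_{12}\eta_1\eta_2=\varepsilon_{23}\eta_2\eta_3=-\varepsilon_{13}\eta_1\eta_3$, where $\eta_k=+1$ if along the orientation the endpoint on $s_k$ of the arrow joining $s_k$ and $s_{k-1}$ precedes that of the arrow joining $s_k$ and $s_{k+1}$ (indices mod 3), and $-1$ otherwise; (OC) exchange two adjacent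 tails. The monoid $\mathrm{wSL}_n$ of welded string links is the quotient of Gauss diagrams on $n$ strands by these moves (equivalently, virtual string link diagrams up to welded Reidemeister moves), and $\mathrm{wSL}_n^\mu$ is its quotient by a move $\mu$. $\mathrm{CC}$ (crossing change): reverse the direction of an arrow and change its sign. For $i\neq j$, $\mathrm{vlk}_{ij}$ is the sum of the signs of all arrows with tail on strand $i$ and head on strand $j$. *)

(* Defs.v *)
From HB Require Import structures.
From mathcomp Require Import all_boot all_order all_algebra.
From mathcomp Require Import boolp.
From Stdlib Require Import Relation_Operators.

Set Implicit Arguments.
Unset Strict Implicit.
Unset Printing Implicit Defensive.

Import GRing.Theory.
Local Open Scope ring_scope.

(* An arrow is a name [k : nat] together with its sign ([true] is +1); only
   the sign is meaningful, names being immaterial (see [same_diagram]). *)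
Notation arrow := (nat * bool)%type.

Definition sign_val (b : bool) : int := if b then 1 else -1.
Definition sign (a : arrow) : int := sign_val a.2.

Notation endpoint := (arrow * bool)%type.

Definition tail_of (a : arrow) : endpoint := (a, false).
Definition head_of (a : arrow) : endpoint := (a, true).

(* The i-th word lists the endpoints met along the oriented i-th strand. *)
Notation code n := {ffun 'I_n -> seq endpoint}.

Definition endpoints n (s : code n) : seq endpoint :=
  flatten [seq s i | i <- enum 'I_n].

(* Every arrow that occurs has exactly one tail and exactly one head. *)
Definition wf_code n (s : code n) : bool :=
  uniq (endpoints s) &&
  all (fun e => (e.1, ~~ e.2) \in endpoints s) (endpoints s).

Record gauss (n : nat) := Gauss { strand :> code n; _ : wf_code strand }.
HB.instance Definition _ n := [isSub for @strand n].
HB.instance Definition _ n := [Countable of gauss n by <:].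

Definition arrows n (D : gauss n) : seq arrow :=
  [seq e.1 | e <- endpoints D & ~~ e.2].

(* Homeomorphic diagrams: only the names of the arrows differ.  Since [E] is
   well formed, [f] is injective on the arrows of [D]. *)
Definition same_diagram n (D E : gauss n) : Prop :=
  exists2 f : arrow -> arrow,
    {in arrows D, forall a, (f a).2 = a.2} &
    forall i, E i = [seq (f e.1, e.2) | e <- D i].

(* [x] and [y] are adjacent, [x] preceding [y] along the orientation. *)
Definition precedes n (D : gauss n) (x y : endpoint) : Prop :=
  exists i, infix [:: x; y] (D i).

Definition adjacent n (D : gauss n) (x y : endpoint) : Prop :=
  precedes D x y \/ precedes D y x.

Definition remove (s : seq arrow) (w : seq endpoint) : seq endpoint :=
  [seq e <- w | e.1 \notin s].

Definition exch (x y e : endpoint) : endpoint :=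
  if e == x then y else if e == y then x else e.

(* R1 and R2 are given in the deleting direction. *)
Definition R1 n (D E : gauss n) : Prop :=
  exists a, adjacent D (tail_of a) (head_of a) /\
    forall i, E i = remove [:: a] (D i).

Definition R2 n (D E : gauss n) : Prop :=
  exists a b, [/\ sign a = - sign b,
    adjacent D (tail_of a) (tail_of b), adjacent D (head_of a) (head_of b) &
    forall i, E i = remove [:: a; b] (D i)].

Definition portion n (D : gauss n) (b : bool) (x y : endpoint) : Prop :=
  if b then precedes D x y else precedes D y x.

(* [b1], [b2], [b3] encode the signs eta_1, eta_2, eta_3; on the k-th portion
   the endpoint of the arrow joining s_k and s_(k-1) is written first. *)
Definition R3 n (D E : gauss n) : Prop :=
  exists (a12 a23 a13 : arrow) (b1 b2 b3 : bool),
  let eta1 := sign_val b1 in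
  let eta2 := sign_val b2 in
  let eta3 := sign_val b3 in
  [/\ uniq [:: a12; a23; a13],
      [/\ portion D b1 (tail_of a13) (tail_of a12),
          portion D b2 (head_of a12) (tail_of a23) &
          portion D b3 (head_of a23) (head_of a13)],
      sign a12 * eta1 * eta2 = sign a23 * eta2 * eta3,
      sign a23 * eta2 * eta3 = - (sign a13 * eta1 * eta3) &
      forall i, E i = [seq exch (tail_of a13) (tail_of a12)
                            (exch (head_of a12) (tail_of a23)
                              (exch (head_of a23) (head_of a13) e)) | e <- D i]].

Definition OC n (D E : gauss n) : Prop :=
  exists a b, adjacent D (tail_of a) (tail_of b) /\
    forall i, E i = [seq exch (tail_of a) (tail_of b) e | e <- D i].

Definition welded_move n (D E : gauss n) : Prop :=
  [\/ R1 D E, R2 D E, R3 D E | OC D E].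

(* As names carry signs, the reversed arrow [b] has a new name; it cannot
   already occur in [D], for otherwise [E] would not be well formed. *)
Definition CC n (D E : gauss n) : Prop :=
  exists a b, [/\ a \in arrows D, sign b = - sign a &
    forall i, E i = [seq if e.1 == a then (b, ~~ e.2) else e | e <- D i]].

(* Even names are used for the first diagram, odd names for the second. *)
Definition lift_arrow (b : bool) (a : arrow) : arrow := (b + a.1.*2, a.2)%N.
Definition lift_end (b : bool) (e : endpoint) : endpoint :=
  (lift_arrow b e.1, e.2).

Definition stack_code n (s t : code n) : code n :=
  [ffun i => map (lift_end false) (s i) ++ map (lift_end true) (t i)].

Definition empty_code n : code n := [ffun=> [::]].

Lemma lift_arrow_inj b : injective (lift_arrow b).
Proof.
move=> [k s] [l t] [/addnI kl ->]; congr (_, _).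
by rewrite -(doubleK k) kl doubleK.
Qed.

Lemma lift_end_inj b : injective (lift_end b).
Proof.
move=> [a s] [c t] [/= kl st ->]; congr (_, _).
by apply: (@lift_arrow_inj b); rewrite /lift_arrow kl st.
Qed.

Lemma lift_arrow_neq b a c : (lift_arrow (~~ b) a == lift_arrow b c) = false.
Proof.
apply/negP => /eqP[/(congr1 odd)]; rewrite !oddD !odd_double !addbF => + _.
by case: b.
Qed.

Lemma lift_end_neq b x y : (lift_end (~~ b) x == lift_end b y) = false.
Proof. by rewrite -pair_eqE /= lift_arrow_neq. Qed.

Lemma endpoints_stack n (s t : code n) :
  perm_eq (endpoints (stack_code s t))
    (map (lift_end false) (endpoints s) ++ map (lift_end true) (endpoints t)).
Proof.
rewrite /endpoints; elim: (enum _) => //= i r IH.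
rewrite ffunE !map_cat -!catA perm_cat2l.
apply: perm_trans (perm_cat (perm_refl _) IH) _.
by rewrite perm_catCA.
Qed.

Lemma stack_wf n (D E : gauss n) : wf_code (stack_code D E).
Proof.
case: D E => [s /andP[us ws]] [t /andP[ut wt]] /=.
have st := endpoints_stack s t; apply/andP; split.
  rewrite (perm_uniq st) cat_uniq !map_inj_uniq ?us ?ut ?andbT //=;
    try exact: lift_end_inj.
  apply/hasPn => _ /mapP[x _ ->]; apply/mapP => -[y _ /eqP].
  by rewrite (lift_end_neq false).
apply/allP => e; rewrite !(perm_mem st) !mem_cat.
by case/orP => /mapP[x xs ->]; [have := allP ws _ xs | have := allP wt _ xs];
  move/(map_f (lift_end _)) => H; apply/orP; [left | right]; exact: H.
Qed.

Lemma empty_wf n : wf_code (empty_code n).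
Proof.
rewrite /wf_code; suff -> : endpoints (empty_code n) = [::] by [].
by rewrite /endpoints; elim: (enum _) => //= i r ->; rewrite ffunE.
Qed.

Definition stack n (D E : gauss n) : gauss n := Gauss (stack_wf D E).
Definition empty_diagram n : gauss n := Gauss (empty_wf n).

(* Moves act on portions of diagrams, so they can be performed inside a stack;
   this makes the quotients below monoids. *)
Record local_move n := LocalMove {
  move_rel :> gauss n -> gauss n -> Prop;
  move_local : forall D D' E, move_rel D D' ->
    move_rel (stack D E) (stack D' E) /\ move_rel (stack E D) (stack E D') }.

Section Locality.
Variable n : nat.
Implicit Types D E F : gauss n.

Let ctx b E D := if b then stack E D else stack D E.

Let ctx_infix b E D w i :
  infix w (D i) -> infix (map (lift_end b) w) (ctx b E D i).
Proof.
have im (g : endpoint -> endpoint) v u : infix v u -> infix (map g v) (map g u).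
  by move=> /infixP[p [q ->]]; rewrite !map_cat infix_infix.
by case: b => /im h; rewrite ffunE; [apply: infix_catl | apply: infix_catr].
Qed.

Let ctx_precedes b E D x y :
  precedes D x y -> precedes (ctx b E D) (lift_end b x) (lift_end b y).
Proof. by move=> [i /ctx_infix h]; exists i; apply: h. Qed.

Let ctx_adjacent b E D x y :
  adjacent D x y -> adjacent (ctx b E D) (lift_end b x) (lift_end b y).
Proof. by case=> /ctx_precedes h; [left | right]; apply: h. Qed.

Let ctx_portion b E D c x y :
  portion D c x y -> portion (ctx b E D) c (lift_end b x) (lift_end b y).
Proof. by case: c => /ctx_precedes; apply. Qed.

Let ctx_remove b E D D' s :
  (forall i, D' i = remove s (D i)) ->
  forall i, ctx b E D' i = remove (map (lift_arrow b) s) (ctx b E D i).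
Proof.
have r1 c w : map (lift_end c) (remove s w) =
    remove (map (lift_arrow c) s) (map (lift_end c) w).
  rewrite /remove filter_map; congr map; apply: eq_filter => e /=.
  by rewrite mem_map //; apply: lift_arrow_inj.
have r2 c w :
    map (lift_end (~~ c)) w =
    remove (map (lift_arrow c) s) (map (lift_end (~~ c)) w).
  apply/esym/all_filterP/allP => _ /mapP[e _ ->] /=.
  by apply/mapP => -[a _ /eqP]; rewrite lift_arrow_neq.
move=> h i; case: b; rewrite /ctx /= !ffunE h r1 /remove filter_cat.
  by rewrite -/(remove _ (map (lift_end false) _)) -(r2 true).
by rewrite -/(remove _ (map (lift_end true) _)) -(r2 false).
Qed.

Let ctx_map b E D D' (g h : endpoint -> endpoint) :
  (forall i, {in D i, forall e, h (lift_end b e) = lift_end b (g e)}) ->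
  (forall e, h (lift_end (~~ b) e) = lift_end (~~ b) e) ->
  (forall i, D' i = map g (D i)) ->
  forall i, ctx b E D' i = map h (ctx b E D i).
Proof.
move=> h1 h2 Dg i; case: b h1 h2 => h1 h2; rewrite /ctx /= !ffunE Dg map_cat.
all: rewrite -!map_comp; congr (_ ++ _); try (by apply: eq_map => e; rewrite /= h2).
all: by apply/eq_in_map => e De; rewrite /= (h1 i).
Qed.

Let exch_lift b x y e :
  exch (lift_end b x) (lift_end b y) (lift_end b e) = lift_end b (exch x y e).
Proof. by rewrite /exch !(inj_eq (@lift_end_inj b)); do !case: eqP. Qed.

Let exch_other b x y e :
  exch (lift_end b x) (lift_end b y) (lift_end (~~ b) e) = lift_end (~~ b) e.
Proof. by rewrite /exch !lift_end_neq. Qed.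

Lemma mem_arrows D i e : e \in D i -> e.1 \in arrows D.
Proof.
case: D => s /= ws es; have [_ /allP h] := andP ws.
have eE : e \in endpoints s.
  by apply/flattenP; exists (s i) => //; apply: map_f; rewrite mem_enum.
apply/mapP; case: e {es} eE => a [] eE; exists (tail_of a) => //.
  by rewrite mem_filter; have := h _ eE.
by rewrite mem_filter.
Qed.

Let mem_arrows_ctx b E D a :
  (lift_arrow b a \in arrows (ctx b E D)) = (a \in arrows D).
Proof.
have memA F c : (c \in arrows F) = (tail_of c \in endpoints F).
  apply/mapP/idP => [[[d k]] | h].
    by rewrite mem_filter /= => /andP[/negbTE -> h ->].
  by exists (tail_of c); rewrite // mem_filter.
have other (c : bool) s :
    (tail_of (lift_arrow b a) \in map (lift_end (~~ b)) s) = false.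
  apply/mapP => -[e _ /eqP]; rewrite -[tail_of _]/(lift_end b (tail_of a)).
  by rewrite eq_sym lift_end_neq.
have same s : (tail_of (lift_arrow b a) \in map (lift_end b) s) = (tail_of a \in s).
  by rewrite -[tail_of _]/(lift_end b (tail_of a)) mem_map //; apply: lift_end_inj.
rewrite !memA /ctx; case: b other same => other same /=;
  rewrite (perm_mem (endpoints_stack _ _)) mem_cat.
all: by rewrite (other true) same ?orbF.
Qed.

Let ctx_same b E D D' :
  same_diagram D D' -> same_diagram (ctx b E D) (ctx b E D').
Proof.
move=> [f fs fD].
pose g (a : arrow) :=
  if odd a.1 == b then lift_arrow b (f (a.1./2, a.2)) else a.
have g1 a : g (lift_arrow b a) = lift_arrow b (f a).
  rewrite /g /= oddD odd_double addbF half_bit_double -surjective_pairing.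
  by case: (b); rewrite eqxx.
have g2 a : g (lift_arrow (~~ b) a) = lift_arrow (~~ b) a.
  by rewrite /g /= oddD odd_double addbF; case: (b).
exists g; last first.
  refine (@ctx_map b E D D' _ (fun e => (g e.1, e.2)) _ _ fD) => [i e _|e].
    by rewrite /lift_end /= g1.
  by rewrite /lift_end /= g2.
move=> c; have [/eqP cb|cb _] := boolP (odd c.1 == b); last first.
  by rewrite /g (negbTE cb).
have -> : c = lift_arrow b (c.1./2, c.2).
  by rewrite /lift_arrow /= -cb odd_double_half; case: (c).
by rewrite mem_arrows_ctx g1 /= => /fs ->.
Qed.

Let ctx_welded b E D D' :
  welded_move D D' -> welded_move (ctx b E D) (ctx b E D').
Proof.
case.
- move=> [a [ad h]]; constructor 1; exists (lift_arrow b a); split.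
    exact: (ctx_adjacent _ _ ad).
  exact: (ctx_remove _ _ h).
- move=> [a [c [s adt adh h]]]; constructor 2.
  exists (lift_arrow b a), (lift_arrow b c); split => //.
  + exact: (ctx_adjacent _ _ adt).
  + exact: (ctx_adjacent _ _ adh).
  + exact: (ctx_remove _ _ h).
- move=> [a12 [a23 [a13 [b1 [b2 [b3 [u [p1 p2 p3] s1 s2 h]]]]]]].
  constructor 3; exists (lift_arrow b a12), (lift_arrow b a23).
  exists (lift_arrow b a13), b1, b2, b3; split => //.
  + by rewrite -(map_inj_uniq (@lift_arrow_inj b)) in u.
  + by split; [apply: (ctx_portion _ _ p1) | apply: (ctx_portion _ _ p2) |
               apply: (ctx_portion _ _ p3)].
  + refine (@ctx_map b E D D' _ (fun e =>
      exch (lift_end b (tail_of a13)) (lift_end b (tail_of a12))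
        (exch (lift_end b (head_of a12)) (lift_end b (tail_of a23))
          (exch (lift_end b (head_of a23)) (lift_end b (head_of a13)) e))) _ _ h)
      => [i e _|e]; last by rewrite !exch_other.
    by rewrite !exch_lift.
- move=> [a [c [ad h]]]; constructor 4.
  exists (lift_arrow b a), (lift_arrow b c); split.
    exact: (ctx_adjacent _ _ ad).
  refine (@ctx_map b E D D' _ (exch (lift_end b (tail_of a)) (lift_end b (tail_of c))) _ _ h)
    => [i e _|e]; last exact: exch_other.
  exact: exch_lift.
Qed.

Let ctx_CC b E D D' : CC D D' -> CC (ctx b E D) (ctx b E D').
Proof.
move=> [a [c [aD s h]]]; exists (lift_arrow b a), (lift_arrow b c); split => //.
  by rewrite mem_arrows_ctx.
refine (@ctx_map b E D D' _ (fun e =>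
  if e.1 == lift_arrow b a then (lift_arrow b c, ~~ e.2) else e) _ _ h)
  => [i e _|e] /=; last by rewrite lift_arrow_neq.
by rewrite (inj_eq (@lift_arrow_inj b)); case: eqP.
Qed.

Lemma same_diagram_local D D' E : same_diagram D D' ->
  same_diagram (stack D E) (stack D' E) /\ same_diagram (stack E D) (stack E D').
Proof. by move=> h; split; [apply: (@ctx_same false) | apply: (@ctx_same true)]. Qed.

Lemma welded_move_local D D' E : welded_move D D' ->
  welded_move (stack D E) (stack D' E) /\ welded_move (stack E D) (stack E D').
Proof. by move=> h; split; [apply: (@ctx_welded false) | apply: (@ctx_welded true)]. Qed.

Lemma CC_local D D' E : CC D D' ->
  CC (stack D E) (stack D' E) /\ CC (stack E D) (stack E D').
Proof. by move=> h; split; [apply: (@ctx_CC false) | apply: (@ctx_CC true)]. Qed.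

End Locality.

Definition crossing_change n : local_move n := LocalMove (@CC_local n).

Section Quotient.
Variables (n : nat) (mu : local_move n).
Implicit Types D E F : gauss n.

Definition step D E : Prop :=
  [\/ same_diagram D E, welded_move D E | mu D E].

Definition w_equiv : gauss n -> gauss n -> Prop := clos_refl_sym_trans _ step.

Definition w_equivb D E : bool := `[< w_equiv D E >].

Lemma w_equivb_refl : reflexive w_equivb.
Proof. by move=> D; apply/asboolP; apply: rst_refl. Qed.

Lemma w_equivb_sym : symmetric w_equivb.
Proof. by move=> D E; apply/asboolP/asboolP => ?; apply: rst_sym. Qed.

Lemma w_equivb_trans : transitive w_equivb.
Proof. by move=> E D F /asboolP DE /asboolP EF; apply/asboolP/(@rst_trans _ _ D E F). Qed.

Canonical w_equivb_equiv :=
  EquivRel w_equivb w_equivb_refl w_equivb_sym w_equivb_trans.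

Local Open Scope quotient_scope.

(* The quotient of Gauss diagrams by welded moves and [mu]. *)
Definition wSL : Type := {eq_quot w_equivb}.
HB.instance Definition _ := Choice.on wSL.
HB.instance Definition _ := EqQuotient.on wSL.

Definition wSL_class (D : gauss n) : wSL := \pi_wSL D.

Lemma wSL_classP D E : wSL_class D = wSL_class E <-> w_equiv D E.
Proof. by split=> [/eqmodP/asboolP|DE] //; apply/eqmodP/asboolP. Qed.

Lemma stack_w_equiv D D' E E' :
  w_equiv D D' -> w_equiv E E' -> w_equiv (stack D E) (stack D' E').
Proof.
have st A B C : step A B ->
    step (stack A C) (stack B C) /\ step (stack C A) (stack C B).
  case=> h.
  - by have [] := same_diagram_local C h; split; constructor 1.
  - by have [] := welded_move_local C h; split; constructor 2.
  - by have [] := move_local C h; split; constructor 3.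
move=> DD EE; apply: (@rst_trans _ _ _ (stack D' E)).
  elim: DD => {D D'} [A B h|A|A B _ h|A B C _ h1 _ h2].
  - by apply: rst_step; case: (st _ _ E h).
  - exact: rst_refl.
  - exact: rst_sym.
  - exact: rst_trans h1 h2.
elim: EE => {E E'} [A B h|A|A B _ h|A B C _ h1 _ h2].
- by apply: rst_step; case: (st _ _ D' h).
- exact: rst_refl.
- exact: rst_sym.
- exact: rst_trans h1 h2.
Qed.

Definition wSL_mul (x y : wSL) : wSL := wSL_class (stack (repr x) (repr y)).
Definition wSL_one : wSL := wSL_class (empty_diagram n).

Lemma wSL_mul_class D E :
  wSL_mul (wSL_class D) (wSL_class E) = wSL_class (stack D E).
Proof.
by apply/wSL_classP/stack_w_equiv; apply/wSL_classP; rewrite /wSL_class reprK.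
Qed.

Lemma wSL_ind (P : wSL -> Prop) : (forall D, P (wSL_class D)) -> forall x, P x.
Proof. by move=> h x; rewrite -[x]reprK; apply: h. Qed.

Lemma same_class D E : same_diagram D E -> wSL_class D = wSL_class E.
Proof. by move=> h; apply/wSL_classP/rst_step; constructor 1. Qed.

Lemma wSL_mulA : associative wSL_mul.
Proof.
elim/wSL_ind => D; elim/wSL_ind => E; elim/wSL_ind => F.
rewrite !wSL_mul_class; apply: same_class.
pose f (k : nat) := if ~~ odd k then k.*2 else
  if ~~ odd k./2 then (k./2./2.*2).+1.*2 else k./2.
exists (fun a => (f a.1, a.2)) => // i; rewrite !ffunE !map_cat -catA.
congr (_ ++ (_ ++ _)); rewrite -!map_comp; apply: eq_map => -[[k s] b] //=;
  rewrite /lift_end /lift_arrow /f /= ?add0n ?add1n /= ?odd_double /=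
          ?uphalf_double ?doubleK /= ?odd_double /= ?doubleK //.
Qed.

Lemma wSL_mul1 : left_id wSL_one wSL_mul.
Proof.
elim/wSL_ind => D; rewrite wSL_mul_class; apply: same_class.
exists (fun a => (a.1./2, a.2)) => // i; rewrite !ffunE /= -map_comp map_id_in //.
by move=> [[k s] b] _ /=; rewrite uphalf_double.
Qed.

Lemma wSL_mulr1 : right_id wSL_one wSL_mul.
Proof.
elim/wSL_ind => D; rewrite wSL_mul_class; apply: same_class.
exists (fun a => (a.1./2, a.2)) => // i; rewrite !ffunE /= cats0 -map_comp map_id_in //.
by move=> [[k s] b] _ /=; rewrite doubleK.
Qed.

HB.instance Definition _ := isMonoid.Build wSL wSL_mulA wSL_mul1 wSL_mulr1.

End Quotient.

Definition monoid_iso (M : monoidType) (V : nmodType) (f : M -> V) : Prop :=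
  [/\ bijective f, f 1%g = 0 & {morph f : x y / (x * y)%g >-> x + y}].

(* [f], a map on Gauss diagrams, w-classifies the move [mu]. *)
Definition w_classifies n (mu : local_move n) (V : nmodType)
    (f : gauss n -> V) : Prop :=
  [/\ forall D E, same_diagram D E -> f D = f E,
      forall D E, welded_move D E -> f D = f E,
      forall D E, mu D E -> f D = f E &
      exists2 phi : wSL mu -> V,
        (forall D, phi (wSL_class mu D) = f D) & monoid_iso phi].

Definition vlk n (i j : 'I_n) (D : gauss n) : int :=
  \sum_(a <- arrows D | (tail_of a \in D i) && (head_of a \in D j)) sign a.

Notation ord_pair n := {p : 'I_n * 'I_n | (p.1 < p.2)%N}.

Lemma card_ord_pair n : #|{: ord_pair n}| = ((n * n.-1) %/ 2)%N.
Proof.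
rewrite card_sig -sum1_card (eq_bigl (fun p : 'I_n * 'I_n => (p.1 < p.2)%N)) //.
rewrite -(pair_big_dep xpredT (fun i j : 'I_n => (i < j)%N) (fun _ _ => 1%N)) /=.
rewrite (exchange_big_dep xpredT) //= divn2 -bin2 -bin2_sum big_mkord.
apply: eq_bigr => j _.
by rewrite (big_ord_narrow (ltnW (ltn_ord j))) sum1_card card_ord.
Qed.

(* Main.v *)
Require Import Defs.
From HB Require Import structures.
From mathcomp Require Import all_boot all_order all_algebra.
From Stdlib Require Import Relation_Operators.

Set Implicit Arguments.
Unset Strict Implicit.
Unset Printing Implicit Defensive.

Import GRing.Theory.
Local Open Scope ring_scope.

(** Crossing changes and the exchange of adjacent tails already make every
    pair of adjacent endpoints exchangeable up to equivalence: a crossing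
    change turns a head into a tail, so two adjacent endpoints of distinct
    arrows can first be made tails, then exchanged, then turned back
    ([cl_swap_reverse], [cl_swap]); if they belong to the same arrow, both
    orders are deleted to the same diagram by R1.  Hence the class of a diagram
    only depends on which endpoints lie on which strand ([cl_rearranged]), and
    the third Reidemeister move is a consequence of the others.

    It follows that the quotient is commutative and that a diagram is
    the product of its arrows, each taken alone: an arrow from strand [i] to
    strand [j] splits off as a factor [arrow_diagram i j b].  These generators
    satisfy three relations, one for each remaining move: [cl_self_arrow] (R1)
    kills them for [i = j], [cl_opposite_arrow] (R2) makes the two signs
    inverse to each other, and [cl_reverse_arrow] (CC) exchanges [i] and [j]
    at the cost of the sign.  So the quotient is generated by one invertible
    element for each pair [i < j].

    The invariant [lk] satisfies the same relations, is additive under stacking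
    and is blind to the order of endpoints, so that the same decomposition
    also proves its invariance under all the moves.  It takes the generators to
    the standard basis of the free abelian group.  Therefore [arrow_product],
    which sends an integer vector to the corresponding product of generators,
    is inverse to it: [cl_arrow_product] by induction on the number of arrows,
    [lk_class_product] by evaluating on generators. *)

(** * Words up to permutation *)

(** By selection sort: the letters of the target word are brought to their
    places from left to right, each by exchanges of neighbours. *)
Lemma perm_eq_adjacent (T : eqType) (R : seq T -> seq T -> Prop) :
  (forall s, R s s) ->
  (forall t s u, R s t -> R t u -> R s u) ->
  (forall u x y v, R (u ++ [:: x, y & v]) (u ++ [:: y, x & v])) ->
  forall s t, perm_eq s t -> R s t.
Proof.
move=> Rxx Rtr Rsw s t st.
(* A letter can be brought to the front, one exchange at a time. *)
have front u x w v : R (u ++ w ++ x :: v) (u ++ x :: w ++ v).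
  elim: w u => [|y w IHw] u; first exact: Rxx.
  apply: (Rtr (u ++ [:: y, x & w ++ v])); last exact: Rsw.
  by have := IHw (rcons u y); rewrite !cat_rcons.
suff gen u : R (u ++ s) (u ++ t) by exact: (gen [::]).
elim: t s st u => [|x t IHt] s st u.
  by rewrite (perm_nilP st); apply: Rxx.
have xs : x \in s by rewrite (perm_mem st) mem_head.
case/splitPr: xs st => s1 s2 st.
apply: (Rtr (u ++ x :: s1 ++ s2)); first exact: front.
have := IHt (s1 ++ s2) _ (rcons u x); rewrite !cat_rcons; apply.
by rewrite -(perm_cons x) -(permPr st) -cat1s perm_catCA.
Qed.

Lemma exch_perm (x y : endpoint) (s : seq endpoint) :
  uniq s -> (x \in s) = (y \in s) -> perm_eq [seq exch x y e | e <- s] s.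
Proof.
move=> us xys.
have exK : involutive (exch x y).
  move=> e; rewrite /exch; case: (eqVneq e x) => [->|ex].
    by rewrite eqxx; case: eqP => // ->.
  case: (eqVneq e y) => [->|ey]; first by rewrite eqxx.
  by rewrite (negbTE ex) (negbTE ey).
apply: uniq_perm => //; first by rewrite map_inj_uniq //; apply: inv_inj.
move=> e; rewrite -{1}[e]exK mem_map; last exact: inv_inj.
by rewrite /exch; case: eqP => [->|_]; [|case: eqP => [->|]].
Qed.

(** * Words of Gauss diagrams *)

Section Codes.
Variable n : nat.
Implicit Types (s t : code n) (D E F : gauss n) (i j k : 'I_n).

Lemma count_endpoints s (p : pred endpoint) :
  count p (endpoints s) = (\sum_i count p (s i))%N.
Proof. by rewrite count_flatten -map_comp sumnE big_map big_enum. Qed.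

Lemma mem_endpoints s i e : e \in s i -> e \in endpoints s.
Proof. by move=> es; apply/flattenP; exists (s i); rewrite ?map_f ?mem_enum. Qed.

Lemma endpoints_perm s t :
  (forall i, perm_eq (s i) (t i)) -> perm_eq (endpoints s) (endpoints t).
Proof.
move=> st; apply/permP => p; rewrite !count_endpoints.
by apply: eq_bigr => i _; apply/permP.
Qed.

Lemma gaussP D : wf_code D. Proof. by case: D. Qed.

Lemma wf_code_perm D s : (forall i, perm_eq (s i) (D i)) -> wf_code s.
Proof.
move=> /endpoints_perm sD; have [uD cD] := andP (gaussP D).
rewrite /wf_code (perm_uniq sD) uD (perm_all _ sD).
by apply: sub_all cD => e; rewrite (perm_mem sD).
Qed.

Lemma gauss_eq D E : (forall i, D i = E i) -> D = E.
Proof. by move=> DE; apply: val_inj; apply/ffunP. Qed.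

Lemma endpoints_uniq D : uniq (endpoints D).
Proof. by case/andP: (gaussP D). Qed.

Lemma count_strand_le1 D i e : (count_mem e (D i) <= 1)%N.
Proof.
apply: leq_trans (_ : (count_mem e (endpoints D) <= _)%N).
  by rewrite count_endpoints (bigD1 i) //= leq_addr.
by rewrite count_uniq_mem ?endpoints_uniq // leq_b1.
Qed.

Lemma strand_uniq D i : uniq (D i).
Proof.
apply: count_mem_uniq => e; have := count_strand_le1 D i e.
by rewrite -has_pred1 has_count; case: count => [|[]].
Qed.

Lemma strand_inj D i j e : e \in D i -> e \in D j -> i = j.
Proof.
move=> ei ej; apply/eqP; apply: contraTT isT => ij.
have: (count_mem e (endpoints D) <= 1)%N.
  by rewrite count_uniq_mem ?endpoints_uniq // leq_b1.
rewrite count_endpoints (bigD1 i) //= (bigD1 j) 1?eq_sym //=.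
move: ei ej; rewrite -!has_pred1 !has_count.
case: (count _ (D i)) (count _ (D j)) => [|p] [|q] //= _ _.
by rewrite addSn addnS.
Qed.

Lemma arrow_endpoints D a b : a \in arrows D -> (a, b) \in endpoints D.
Proof.
case/mapP=> -[c d]; rewrite mem_filter => /andP[/= d0 cD] ->.
case/andP: (gaussP D) => _ /allP/(_ _ cD); case: d d0 cD => //.
by case: b.
Qed.

Lemma arrow_strand D a b : a \in arrows D -> exists i, (a, b) \in D i.
Proof.
by case/(arrow_endpoints b)/flattenP => _ /mapP[i _ ->]; exists i.
Qed.

Lemma endpoint_arrow D e : e \in endpoints D -> e.1 \in arrows D.
Proof. by case/flattenP => _ /mapP[i _ ->]; apply: mem_arrows. Qed.

Lemma sum_endpoints s (P : pred endpoint) (G : endpoint -> int) :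
  \sum_(e <- endpoints s | P e) G e = \sum_i \sum_(e <- s i | P e) G e.
Proof. by rewrite big_flatten big_map big_enum. Qed.

(** Reading [vlk] along the strand that carries the tails makes it
    accessible to strandwise arguments: the sum no longer ranges over the whole
    diagram. *)
Lemma vlkE i j D :
  vlk i j D = \sum_(e <- D i | ~~ e.2 && (head_of e.1 \in D j)) sign e.1.
Proof.
rewrite /vlk big_map big_filter_cond sum_endpoints (bigD1 i) //=.
rewrite [X in _ + X]big1 ?addr0 => [|k ki].
  rewrite big_seq_cond [RHS]big_seq_cond.
  apply: eq_bigl => -[a []]; rewrite ?andbF //=.
  by case aD: (_ \in _) => //=; rewrite aD.
rewrite big_seq_cond big1 // => -[a [] /and3P[//= ak _ /andP[ai _]]].
by case/eqP: ki; apply: strand_inj ai.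
Qed.

End Codes.
(** * Exchanging adjacent endpoints *)

Section Exchange.
Variable n : nat.
Implicit Types (s t : code n) (D E F : gauss n) (i j k : 'I_n).

Local Notation cl := (wSL_class (crossing_change n)).

Lemma cl_move D E : welded_move D E -> cl D = cl E.
Proof. by move=> DE; apply/wSL_classP/rst_step; constructor 2. Qed.

Lemma cl_CC D E : CC D E -> cl D = cl E.
Proof. by move=> DE; apply/wSL_classP/rst_step; constructor 3. Qed.

Lemma delete_wf D a : wf_code ([ffun i => remove [:: a] (D i)] : code n).
Proof.
have eE : endpoints [ffun i => remove [:: a] (D i)] = remove [:: a] (endpoints D).
  rewrite /remove filter_flatten /endpoints -[in RHS]map_comp; congr flatten.
  by apply: eq_map => i; rewrite ffunE.
have [uD /allP cD] := andP (gaussP D).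
rewrite /wf_code eE filter_uniq //=; apply/allP => e.
by rewrite !mem_filter => /andP[-> /cD].
Qed.

Definition delete D a : gauss n := Gauss (delete_wf D a).

Lemma cl_delete D a : adjacent D (tail_of a) (head_of a) -> cl D = cl (delete D a).
Proof.
by move=> aD; apply/cl_move; constructor 1; exists a; split=> // i; rewrite ffunE.
Qed.

(** The words are given explicitly, rather than through [exch], so that the
    relation is visibly preserved when an arrow is reversed. *)
Definition swapped D E (x y : endpoint) : Prop :=
  exists i u v, [/\ D i = u ++ [:: x, y & v], E i = u ++ [:: y, x & v] &
    forall k, k != i -> E k = D k].

Lemma swapped_sym D E x y : swapped D E x y -> swapped E D y x.
Proof. by move=> [i [u [v [Di Ei DE]]]]; exists i, u, v; split=> // k /DE. Qed.

Lemma swapped_perm D E x y k : swapped D E x y -> perm_eq (D k) (E k).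
Proof.
move=> [i [u [v [Di Ei DE]]]]; have [->|/DE -> //] := eqVneq k i.
by rewrite Di Ei perm_cat2l -[x :: _]/([:: x] ++ [:: y] ++ v) perm_catCA.
Qed.

Lemma swapped_arrows D E x y a :
  swapped D E x y -> (a \in arrows D) = (a \in arrows E).
Proof.
move=> DE; rewrite /arrows; apply: perm_mem; apply: perm_map; apply: perm_filter.
by apply: endpoints_perm => k; apply: swapped_perm DE.
Qed.

Lemma swapped_mem D E x y :
  swapped D E x y -> exists i, x \in D i /\ y \in D i.
Proof.
by move=> [i [u [v [Di _ _]]]]; exists i; rewrite Di !mem_cat !inE !eqxx !orbT.
Qed.

Lemma swapped_precedes D E x y : swapped D E x y -> precedes D x y.
Proof.
move=> [i [u [v [Di _ _]]]]; exists i; apply/infixP; exists u, v.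
by rewrite Di.
Qed.

Lemma exch_notin (x y : endpoint) (w : seq endpoint) :
  x \notin w -> y \notin w -> [seq exch x y e | e <- w] = w.
Proof.
move=> xw yw; apply: map_id_in => e ew; rewrite /exch.
case: eqP => [ex|_]; first by rewrite -ex ew in xw.
by case: eqP => // ey; rewrite -ey ew in yw.
Qed.

Lemma swapped_exch D E x y :
  swapped D E x y -> forall k, E k = [seq exch x y e | e <- D k].
Proof.
move=> DE k; have [j [xj yj]] := swapped_mem DE.
move: DE => [i [u [v [Di Ei DE]]]]; have [->|ki] := eqVneq k i; last first.
  have ij : i = j by apply: strand_inj xj; rewrite Di mem_cat mem_head orbT.
  rewrite exch_notin ?DE //; apply: contraNN ki => H; apply/eqP.
    by rewrite ij; apply: strand_inj H xj.
  by rewrite ij; apply: strand_inj H yj.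
have := strand_uniq D i; rewrite Di Ei cat_uniq /= !inE !negb_or.
case/and5P => _ /and3P[xu yu _] /andP[xy xv] yv _.
rewrite map_cat /= !exch_notin // {1 2}/exch !eqxx.
by rewrite eq_sym (negbTE xy).
Qed.

Definition reverse (a b : arrow) (e : endpoint) : endpoint :=
  if e.1 == a then (b, ~~ e.2) else e.

(** If [b] occurred in [D], its endpoints would be duplicated. *)
Lemma reverse_wf D a b : b \notin arrows D ->
  wf_code ([ffun k => [seq reverse a b e | e <- D k]] : code n).
Proof.
move=> bD; have [uD /allP cD] := andP (gaussP D).
have -> : wf_code ([ffun k => [seq reverse a b e | e <- D k]] : code n) =
    uniq [seq reverse a b e | e <- endpoints D] &&
    all (fun e => (e.1, ~~ e.2) \in [seq reverse a b e | e <- endpoints D])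
        [seq reverse a b e | e <- endpoints D].
  rewrite /wf_code; suff -> : endpoints [ffun k => [seq reverse a b e | e <- D k]]
      = [seq reverse a b e | e <- endpoints D] by [].
  rewrite map_flatten /endpoints -[in RHS]map_comp; congr flatten.
  by apply: eq_map => k; rewrite ffunE.
apply/andP; split.
  rewrite map_inj_in_uniq // => -[c d] [c' d'] cD' cD''.
  have cb : c != b by apply: contraNneq bD => <-; apply: endpoint_arrow cD'.
  have cb' : c' != b by apply: contraNneq bD => <-; apply: endpoint_arrow cD''.
  rewrite /reverse /=; case: eqP => [->|_]; case: eqP => [->|_].
  - by case=> /negb_inj ->.
  - by case=> bc; rewrite bc eqxx in cb'.
  - by case=> bc; rewrite bc eqxx in cb.
  - by [].
apply/allP => _ /mapP[e eD ->]; apply/mapP; exists (e.1, ~~ e.2); first exact: cD.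
by rewrite /reverse /=; case: ifP.
Qed.

Lemma cl_reverse D a b (bD : b \notin arrows D) :
  a \in arrows D -> b.2 = ~~ a.2 -> cl D = cl (Gauss (reverse_wf a bD)).
Proof.
move=> aD ab; apply: cl_CC; exists a, b; split=> // [|i]; last by rewrite ffunE.
by rewrite /sign ab; case: a.2; rewrite ?opprK.
Qed.

Lemma fresh_name (r : seq arrow) (s : bool) : exists m, (m, s) \notin r.
Proof.
exists (\max_(a <- r) a.1).+1; apply/negP => ks.
by have := @leq_bigmax_seq _ r xpredT (fun a => a.1) _ ks isT; rewrite ltnn.
Qed.

(** Crossing changes at the arrow of [x], performed on both diagrams with the
    same new name, reduce the exchange of a head [x] to that of a tail, and
    leave [y] as it is because it belongs to another arrow. *)
Lemma cl_swap_reverse d :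
  (forall D E x y, ~~ x.2 -> y.2 = d -> x.1 != y.1 ->
     swapped D E x y -> cl D = cl E) ->
  forall D E x y, y.2 = d -> x.1 != y.1 -> swapped D E x y -> cl D = cl E.
Proof.
move=> IH D E x y yd xy DE; case xt: x.2; last by apply: (IH _ _ x y); rewrite ?xt.
have [m bD] := fresh_name (arrows D) (~~ x.1.2); set b := (m, _) in bD.
have bE : b \notin arrows E by rewrite -(swapped_arrows _ DE).
have xD : x.1 \in arrows D.
  by have [i [xi _]] := swapped_mem DE; apply: mem_arrows xi.
have xE : x.1 \in arrows E by rewrite -(swapped_arrows _ DE).
rewrite (cl_reverse bD xD) // (cl_reverse bE xE) //; apply: (IH _ _ (reverse x.1 b x) y) => //.
- by rewrite /reverse eqxx /= xt.
- rewrite /reverse eqxx /=; apply: contraNneq bD => ->.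
  by have [i [_ yi]] := swapped_mem DE; apply: mem_arrows yi.
case: DE => i [u [v [Di Ei DE]]].
have ry : reverse x.1 b y = y by rewrite /reverse eq_sym (negbTE xy).
exists i, (map (reverse x.1 b) u), (map (reverse x.1 b) v).
by split=> [||k' ki]; rewrite /= !ffunE ?Di ?Ei ?DE // map_cat /= ry.
Qed.

(** For distinct arrows, [cl_swap_reverse] is used twice, once for each
    endpoint, to reach two tails, which are exchanged by OC.  For the two
    endpoints of one arrow, R1 deletes that arrow on either side. *)
Lemma cl_swap D E x y : swapped D E x y -> cl D = cl E.
Proof.
move=> DE; have [xy|xy] := eqVneq x.1 y.1; last first.
  apply: (cl_swap_reverse (d := y.2)) xy DE => // {x}D {}E x {}y xt _ xy DE.
  have tails D' E' x' y' : ~~ x'.2 -> y'.2 = false -> x'.1 != y'.1 ->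
      swapped D' E' x' y' -> cl D' = cl E'.
    move: x' y' => [a b] [c d] /= /negbTE -> -> _ DE'.
    apply: cl_move; constructor 4; exists a, c; split.
      by left; apply: swapped_precedes DE'.
    exact: swapped_exch DE'.
  symmetry; apply: (cl_swap_reverse tails) (swapped_sym DE); last by rewrite eq_sym.
  exact: negbTE.
have yx : y = (x.1, ~~ x.2).
  move: DE => [i [u [v [Di _ _]]]]; have := strand_uniq D i.
  rewrite Di cat_uniq /= inE => /and3P[_ _ /andP[+ _]].
  rewrite negb_or => /andP[+ _]; move: x y xy {Di} => [a b] [c d] /= ->.
  by case: b d => [] []; rewrite ?eqxx.
have adj F z : precedes F (x.1, z) (x.1, ~~ z) -> cl F = cl (delete F x.1).
  by case: z => zF; apply: cl_delete; [right | left].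
rewrite (adj D x.2); last by rewrite -yx -surjective_pairing; apply: swapped_precedes DE.
rewrite (adj E (~~ x.2)); last first.
  by rewrite negbK -yx -surjective_pairing; apply: swapped_precedes (swapped_sym DE).
congr cl; apply: gauss_eq => k; rewrite !ffunE.
move: DE => [i [u [v [Di Ei DE]]]]; have [->|/DE -> //] := eqVneq k i.
by rewrite Di Ei /remove !filter_cat /= !inE -xy eqxx.
Qed.

End Exchange.

(** * Diagrams with the same arrows up to the order of endpoints *)

Section Rearrangement.
Variable n : nat.
Implicit Types (D E F : gauss n) (i j k : 'I_n).

Local Notation cl := (wSL_class (crossing_change n)).

(** The strands are permuted one after the other, and each of them by
    exchanges of neighbours; every intermediate code is well formed because it
    has the same endpoints. *)
Lemma cl_perm D E : (forall k, perm_eq (D k) (E k)) -> cl D = cl E.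
Proof.
have one i s t : perm_eq s t -> forall F G : gauss n, F i = s -> G i = t ->
    (forall k, k != i -> G k = F k) -> cl F = cl G.
  move=> st; pose R s t := perm_eq s t /\ forall F G : gauss n, F i = s ->
    G i = t -> (forall k, k != i -> G k = F k) -> cl F = cl G.
  suff: R s t by case.
  apply: perm_eq_adjacent st => {s t}.
  - move=> s; split=> // F G Fi Gi FG; congr cl; apply: gauss_eq => k.
    by have [->|/FG ->] := eqVneq k i; rewrite ?Fi ?Gi.
  - move=> t s u [st Rst] [tu Rtu]; split; first exact: perm_trans tu.
    move=> F G Fi Gi FG.
    have wt : wf_code ([ffun k => if k == i then t else F k] : code n).
      apply: (@wf_code_perm _ F) => k; rewrite ffunE.
      by case: eqP => // ->; rewrite Fi perm_sym.
    rewrite (Rst F (Gauss wt)) // ?(Rtu (Gauss wt) G) //= ?ffunE ?eqxx // => k ki.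
      by rewrite ffunE (negbTE ki) FG.
    by rewrite ffunE (negbTE ki).
  - move=> u x y v; split; last first.
      by move=> F G Fi Gi FG; apply: (@cl_swap _ _ _ x y); exists i, u, v.
    by rewrite perm_cat2l -[x :: _]/([:: x] ++ [:: y] ++ v) perm_catCA.
suff gen (r : seq 'I_n) : forall F, (forall k, perm_eq (F k) (E k)) ->
    (forall k, k \notin r -> F k = E k) -> cl F = cl E.
  by move=> DE; apply: (gen (enum 'I_n) D DE) => k; rewrite mem_enum.
elim: r => [|i r IHr] F FE Fr; first by congr cl; apply: gauss_eq => k; apply: Fr.
have wt : wf_code ([ffun k => if k == i then E i else F k] : code n).
  apply: (@wf_code_perm _ F) => k; rewrite ffunE.
  by case: eqP => // ->; rewrite perm_sym.
rewrite (one i _ _ (FE i) F (Gauss wt)) //= ?ffunE ?eqxx // => [|k /negbTE ki].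
  apply: IHr => k /=; rewrite ffunE; case: eqP => [-> //|/eqP ki] // kr.
  by rewrite Fr // inE negb_or ki.
by rewrite ffunE ki.
Qed.

(** Homeomorphism of diagrams up to the order of endpoints on each strand.  It
    is under this relation that diagrams decompose as stacks of arrows. *)
Definition rearranged D E : Prop :=
  exists2 f : arrow -> arrow, {in arrows D, forall a, (f a).2 = a.2} &
    forall k, perm_eq (E k) [seq (f e.1, e.2) | e <- D k].

Lemma perm_rearranged D E : (forall k, perm_eq (E k) (D k)) -> rearranged D E.
Proof. by move=> DE; exists id => // k; rewrite map_id_in // => -[]. Qed.

Lemma same_rearranged D E : same_diagram D E -> rearranged D E.
Proof. by move=> [f fs DE]; exists f => // k; rewrite DE. Qed.

(** Renaming comes first and permuting second; the diagram in between is
    well formed because its endpoints are those of [E]. *)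
Lemma cl_rearranged D E : rearranged D E -> cl D = cl E.
Proof.
move=> [f fs DE].
have wF : wf_code ([ffun k => [seq (f e.1, e.2) | e <- D k]] : code n).
  by apply: (@wf_code_perm _ E) => k; rewrite ffunE perm_sym.
rewrite (@same_class _ _ D (Gauss wF)); first by apply: cl_perm => k; rewrite ffunE perm_sym.
by exists f => // i; rewrite ffunE.
Qed.

(** Only the strands of the endpoints matter for [vlk]; the injectivity of the
    renaming is needed for the head of [f a] on strand [j] to come from the head
    of [a]. *)
Lemma vlk_rearranged D E i j : rearranged D E -> vlk i j D = vlk i j E.
Proof.
move=> [f fs DE].
have fE : perm_eq (endpoints E) [seq (f e.1, e.2) | e <- endpoints D].
  apply/permP => p; rewrite count_map !count_endpoints.
  by apply: eq_bigr => k _; rewrite (permP (DE k)) count_map.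
(* [f] is injective since its image has no duplicates. *)
have f_inj : {in endpoints D &, injective (fun e : endpoint => (f e.1, e.2))}.
  have uD := endpoints_uniq D; have := endpoints_uniq E.
  rewrite (perm_uniq fE) => uf x y xD yD fxy.
  have := @uniqP _ x _ uf; move/(_ (index x (endpoints D)) (index y (endpoints D))).
  rewrite !inE size_map !index_mem => /(_ xD yD).
  rewrite !(nth_map x) ?index_mem // !nth_index // => /(_ fxy) xy.
  by rewrite -(nth_index x xD) xy nth_index.
rewrite !vlkE (perm_big _ (DE i)) big_map /= big_seq_cond [RHS]big_seq_cond.
rewrite (eq_bigl (fun e => (e \in D i) && (~~ e.2 && (head_of (f e.1) \in E j)))).
  apply: eq_bigr => e /andP[ei _]; rewrite /sign /= fs //.
  exact: mem_arrows ei.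
move=> e; case ei: (e \in D i) => //=; congr (_ && _).
rewrite (perm_mem (DE j)); apply/idP/mapP => [hj | [e' ej' [fe fh]]].
  by exists (head_of e.1).
suff <- : e' = head_of e.1 by [].
have e'D := mem_endpoints ej'.
apply: f_inj => //; last by rewrite /= fe -fh.
exact: arrow_endpoints (mem_arrows ei).
Qed.

(** * Arrows as generators *)

Definition arrow_word (a : arrow) i j k : seq endpoint :=
  nseq (k == i) (tail_of a) ++ nseq (k == j) (head_of a).

Lemma arrow_code_wf i j (b : bool) : wf_code ([ffun k => arrow_word (0%N, b) i j k] : code n).
Proof.
set a := (0%N, b).
have one (l : 'I_n) : (\sum_k (k == l) = 1)%N.
  by rewrite (bigD1 l) //= eqxx big1 ?addn0 // => k /negbTE ->.
have eE : perm_eq (endpoints [ffun k => arrow_word a i j k]) [:: tail_of a; head_of a].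
  apply/permP => p; rewrite count_endpoints /= addn0.
  rewrite (eq_bigr (fun k => (k == i) * p (tail_of a) + (k == j) * p (head_of a))%N).
    by rewrite big_split /= -!big_distrl /= !one !mul1n.
  by move=> k _; rewrite ffunE count_cat !count_nseq mulnC [X in (_ + X)%N]mulnC.
rewrite /wf_code (perm_uniq eE) (perm_all _ eE) /= !(perm_mem eE) !inE /=.
by rewrite !eqxx orbT /= !andbT; apply/eqP => -[].
Qed.

Definition arrow_diagram i j b : gauss n := Gauss (arrow_code_wf i j b).

Lemma delete_split D a i j k : tail_of a \in D i -> head_of a \in D j ->
  perm_eq (D k) (delete D a k ++ arrow_word a i j k).
Proof.
move=> ai aj; rewrite ffunE /arrow_word.
have wE e l : e \in D l -> nseq (k == l) e = [seq x <- D k | x == e].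
  move=> el; transitivity (nseq (count_mem e (D k)) e); last first.
    by rewrite -size_filter; apply/esym/all_pred1P/filter_all.
  rewrite count_uniq_mem ?strand_uniq //; congr nseq; congr nat_of_bool.
  by apply/eqP/idP => [-> // | ek]; apply: strand_inj ek el.
rewrite (wE _ _ ai) (wE _ _ aj) /remove.
apply/permP => p; rewrite !count_cat !count_filter.
elim: (D k) => //= e w ->; case: e => c [] /=; rewrite !inE !xpair_eqE /= ?andbT ?andbF.
all: by case: (p _) (c == a) => [] [] /=; rewrite ?add0n ?add1n ?addnS ?addSn ?addnA.
Qed.

(** The name of [b] in [E] is arbitrary, so that this applies both to a diagram
    minus one of its arrows and to the result of a crossing change. *)
Lemma rearranged_stack E F b i j :
  (forall k, perm_eq (E k) (F k ++ arrow_word b i j k)) ->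
  rearranged (stack F (arrow_diagram i j b.2)) E.
Proof.
move=> EF; exists (fun a => if odd a.1 then b else (a.1./2, a.2)) => [a|k].
  case/(arrow_strand false) => k; rewrite ffunE mem_cat.
  case/orP => /mapP[[c d] + [-> _]] /=; first by rewrite odd_double.
  by rewrite ffunE mem_cat odd_double /= !mem_nseq => /orP[] /andP[_ /eqP[-> _]].
apply: perm_trans (EF k) _; rewrite !ffunE map_cat -!map_comp.
rewrite (eq_map (g := id)); last first.
  by move=> [[c d] e]; rewrite /= odd_double doubleK.
rewrite map_id perm_cat2l /arrow_word /= !map_cat !map_nseq /=.
exact: perm_refl.
Qed.

Lemma vlk_stack D E i j : vlk i j (stack D E) = vlk i j D + vlk i j E.
Proof.
have other b c w : (head_of (lift_arrow (~~ b) c) \in map (lift_end b) w) = false.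
  apply/mapP => -[e _ /eqP].
  by rewrite -[head_of _]/(lift_end (~~ b) (head_of c)) lift_end_neq.
have same b c w :
    (head_of (lift_arrow b c) \in map (lift_end b) w) = (head_of c \in w).
  rewrite -[head_of _]/(lift_end b (head_of c)) mem_map //; exact: lift_end_inj.
rewrite !vlkE !ffunE big_cat !big_map /=; congr (_ + _); apply: eq_bigl => e.
  by rewrite mem_cat same (other true) orbF.
by rewrite mem_cat same (other false).
Qed.

Lemma vlk_empty i j : vlk i j (empty_diagram n) = 0.
Proof. by rewrite vlkE ffunE big_nil. Qed.

Lemma vlk_arrow i j b k l :
  vlk k l (arrow_diagram i j b) = if (k == i) && (l == j) then sign_val b else 0.
Proof.
rewrite vlkE !ffunE big_cat /= [X in _ + X]big1_seq ?addr0; last first.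
  by move=> e; rewrite mem_nseq => /andP[/andP[+ _] /andP[_ /eqP ee]]; rewrite ee.
case: (k == i) => /=; rewrite ?big_nil // big_cons big_nil addr0 /=.
rewrite /arrow_word mem_cat !mem_nseq eqxx andbT.
rewrite (_ : (head_of _ == tail_of _) = false) ?andbF; last by apply/eqP => -[].
by case: (l == j).
Qed.

End Rearrangement.

(** * The linking invariant *)

Section Linking.
Variable n : nat.
Implicit Types (D E F : gauss n) (i j k : 'I_n) (p q : ord_pair n).

Local Notation cl := (wSL_class (crossing_change n)).

Definition lk D : {ffun ord_pair n -> int} :=
  [ffun p => vlk (val p).1 (val p).2 D - vlk (val p).2 (val p).1 D].

Lemma lk_rearranged D E : rearranged D E -> lk D = lk E.
Proof. by move=> DE; apply/ffunP => p; rewrite !ffunE !(vlk_rearranged _ _ DE). Qed.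

Lemma lk_stack D E : lk (stack D E) = lk D + lk E.
Proof. by apply/ffunP => p; rewrite !ffunE !vlk_stack opprD addrACA. Qed.

Lemma lk_empty : lk (empty_diagram n) = 0.
Proof. by apply/ffunP => p; rewrite !ffunE !vlk_empty subrr. Qed.

Lemma lk_self_arrow i b : lk (arrow_diagram i i b) = 0.
Proof.
apply/ffunP => -[[k l] kl]; rewrite !ffunE !vlk_arrow /=.
by rewrite andbC subrr.
Qed.

Lemma lk_reverse_arrow i j b :
  lk (arrow_diagram i j b) = lk (arrow_diagram j i (~~ b)).
Proof.
apply/ffunP => p; rewrite !ffunE !vlk_arrow /= ![(_ == j) && _]andbC.
by do 2!case: ifP => _; case: b.
Qed.

Lemma lk_opposite_arrow i j b :
  lk (arrow_diagram i j b) + lk (arrow_diagram i j (~~ b)) = 0.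
Proof.
apply/ffunP => p; rewrite !ffunE !vlk_arrow.
by do 2!case: ifP => _; case: b.
Qed.

Lemma lk_pair_arrow p q b :
  lk (arrow_diagram (val p).1 (val p).2 b) q = if q == p then sign_val b else 0.
Proof.
case: p q => [[i j] /= ij] [[k l] /= kl]; rewrite ffunE !vlk_arrow /=.
(* Equality in the subtype of pairs is equality of pairs. *)
rewrite -[RHS]/(if (k == i) && (l == j) then sign_val b else 0); have [->|] := eqVneq k i => /=.
  by rewrite [(i == j)]eq_sym; have [ji|] := eqVneq j i; rewrite ?andbF ?subr0 //;
    move: ij; rewrite ji ltnn.
move=> _; rewrite sub0r; case: ifP => [/andP[/eqP li /eqP kj]|]; rewrite ?oppr0 //.
by move: kl; rewrite li kj ltnNge (ltnW ij).
Qed.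

(** All the invariance properties of [lk] rest on this: adding an arrow anywhere
    contributes the value of [lk] on that arrow alone. *)
Lemma lk_split D E a i j : (forall k, perm_eq (E k) (D k ++ arrow_word a i j k)) ->
  lk E = lk D + lk (arrow_diagram i j a.2).
Proof. by move=> /rearranged_stack/lk_rearranged <-; rewrite lk_stack. Qed.

Lemma lk_delete D a i j : tail_of a \in D i -> head_of a \in D j ->
  lk D = lk (delete D a) + lk (arrow_diagram i j a.2).
Proof. by move=> ai aj; apply: lk_split => k; apply: delete_split. Qed.

Lemma precedes_mem D x y : precedes D x y -> exists i, x \in D i /\ y \in D i.
Proof.
by move=> [i /infixP[u [v Di]]]; exists i; rewrite Di !mem_cat !inE !eqxx !orbT.
Qed.

Lemma adjacent_mem D x y : adjacent D x y -> exists i, x \in D i /\ y \in D i.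
Proof. by case=> /precedes_mem[i []]; exists i. Qed.

Lemma exch_strand_perm D x y i k :
  x \in D i -> y \in D i -> perm_eq [seq exch x y e | e <- D k] (D k).
Proof.
move=> xi yi; apply: exch_perm; first exact: strand_uniq.
apply/idP/idP => [xk|yk]; first by rewrite (strand_inj xk xi).
by rewrite (strand_inj yk yi).
Qed.

Lemma sign_opp (a b : arrow) : sign b = - sign a -> b.2 = ~~ a.2.
Proof. by rewrite /sign; case: a.2 b.2 => [] []. Qed.

(** R1 removes an arrow of value 0, and R2 two arrows of opposite values; R3 and
    OC permute the endpoints of each strand, whatever the signs are. *)
Lemma lk_welded D E : welded_move D E -> lk D = lk E.
Proof.
case.
- move=> [a [/adjacent_mem[i [ti hi]] DE]]; rewrite (lk_delete ti hi).
  by rewrite lk_self_arrow addr0; congr lk; apply: gauss_eq => k; rewrite ffunE DE.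
- move=> [a [b [ab /adjacent_mem[i [ati bti]] /adjacent_mem[j [ahj bhj]] DE]]].
  have abs := sign_opp ab; have ba : b != a.
    by apply/eqP => ba; move: abs; rewrite ba; case: a.2.
  rewrite (lk_delete ati ahj) (@lk_delete _ b i j); last 2 first.
  + by rewrite ffunE mem_filter /= inE ba.
  + by rewrite ffunE mem_filter /= inE ba.
  rewrite -addrA abs lk_opposite_arrow addr0; congr lk.
  apply: gauss_eq => k; rewrite !ffunE DE /remove -filter_predI.
  by apply: eq_filter => e; rewrite /= !inE negb_or andbC.
- move=> [a12 [a23 [a13 [b1 [b2 [b3 [_ [p1 p2 p3] _ _ DE]]]]]]].
  have pm c x y : portion D c x y -> exists i, x \in D i /\ y \in D i.
    by case: c => /precedes_mem[i []]; exists i.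
  apply/lk_rearranged/perm_rearranged => k; rewrite DE.
  have step g x y : (exists i, x \in D i /\ y \in D i) ->
      perm_eq (map g (D k)) (D k) -> perm_eq [seq exch x y (g e) | e <- D k] (D k).
    move=> [i [xi yi]] gk; rewrite (map_comp (exch x y) g).
    exact: perm_trans (perm_map _ gk) (exch_strand_perm k xi yi).
  apply: (step _ _ _ (pm _ _ _ p1)); apply: (step _ _ _ (pm _ _ _ p2)).
  by have [i [hi ti]] := pm _ _ _ p3; apply: exch_strand_perm hi ti.
- move=> [a [b [/adjacent_mem[i [ti hi]] DE]]].
  by apply/lk_rearranged/perm_rearranged => k; rewrite DE; apply: exch_strand_perm ti hi.
Qed.

Lemma reverse_arrow_word a b i j k :
  [seq reverse a b e | e <- arrow_word a i j k] =
  nseq (k == i) (head_of b) ++ nseq (k == j) (tail_of b).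
Proof. by rewrite map_cat !map_nseq /reverse /= eqxx. Qed.

(** Away from the reversed arrow nothing changes, and the reversed arrow has
    the same value by [lk_reverse_arrow]. *)
Lemma lk_CC D E : CC D E -> lk D = lk E.
Proof.
move=> [a [b [aD ba DE]]].
have [i ti] := arrow_strand false aD; have [j hj] := arrow_strand true aD.
rewrite (lk_delete ti hj) lk_reverse_arrow -(sign_opp ba); symmetry.
apply: lk_split => k; rewrite DE.
apply: perm_trans (perm_map (reverse a b) (delete_split k ti hj)) _.
rewrite map_cat reverse_arrow_word ffunE map_id_in; last first.
  by move=> e; rewrite mem_filter inE /reverse => /andP[/negbTE ->].
by rewrite perm_cat2l perm_catC.
Qed.

(** * The quotient monoid *)

Lemma cl_stack D E : cl (stack D E) = (cl D * cl E)%g.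
Proof. by rewrite -wSL_mul_class. Qed.

(** Stacking in the other order is a rearrangement.  As even names come from
    the first diagram and odd names from the second, the renaming exchanges
    the parities. *)
Lemma cl_mulC (x y : wSL (crossing_change n)) : commute x y.
Proof.
elim/wSL_ind: x => D; elim/wSL_ind: y => E.
rewrite /commute -!cl_stack; apply: cl_rearranged.
exists (fun a => (if odd a.1 then a.1.-1 else a.1.+1, a.2)) => // k.
rewrite !ffunE map_cat -!map_comp perm_sym perm_catC.
rewrite (eq_map (f := _ \o lift_end true) (g := lift_end false)).
  rewrite (eq_map (f := _ \o lift_end false) (g := lift_end true)) //.
  by move=> [[c d] e]; rewrite /lift_end /lift_arrow /= odd_double.
by move=> [[c d] e]; rewrite /lift_end /lift_arrow /= odd_double.
Qed.

Lemma cl_self_arrow i b : cl (arrow_diagram i i b) = 1%g.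
Proof.
rewrite (@cl_delete _ _ (0%N, b)).
  congr cl; apply: gauss_eq => k; rewrite !ffunE /arrow_word.
  by case: (k == i); rewrite //= !inE eqxx.
by left; exists i; rewrite ffunE /arrow_word eqxx infix_refl.
Qed.

Lemma cl_reverse_arrow i j b :
  cl (arrow_diagram i j b) = cl (arrow_diagram j i (~~ b)).
Proof.
have aD : (0%N, b) \in arrows (arrow_diagram i j b).
  by apply: (@mem_arrows _ _ i (tail_of _)); rewrite ffunE /arrow_word eqxx mem_head.
have bD : (0%N, ~~ b) \notin arrows (arrow_diagram i j b).
  apply/negP => /(arrow_strand false)[k]; rewrite ffunE mem_cat !mem_nseq.
  by case/orP => /andP[_ /eqP[]]; case: b {aD}.
rewrite (cl_reverse bD aD) //; apply: cl_perm => k.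
by rewrite !ffunE reverse_arrow_word perm_catC.
Qed.

Lemma cl_opposite_arrow i j b : i != j ->
  (cl (arrow_diagram i j b) * cl (arrow_diagram i j (~~ b)))%g = 1%g.
Proof.
move=> ij; rewrite -cl_stack; apply: cl_move; constructor 2.
exists (lift_arrow false (0%N, b)), (lift_arrow true (0%N, ~~ b)); split.
- by rewrite /sign; case: b.
- by left; exists i; rewrite !ffunE /arrow_word eqxx (negbTE ij) infix_refl.
- left; exists j; rewrite !ffunE /arrow_word eqxx eq_sym (negbTE ij).
  exact: infix_refl.
move=> k; rewrite !ffunE /arrow_word /remove.
by case: (k == i); case: (k == j) => //=; rewrite !inE !eqxx ?orbT.
Qed.

End Linking.

(** * The inverse of the linking invariant *)

(** In a commutative monoid, changing one factor of a product by [x]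
    changes the product by [x]. *)
Lemma prod_mulr_at (M : monoidType) (I : eqType) (r : seq I) (F G : I -> M) p x :
  (forall u v : M, commute u v) -> uniq r -> p \in r -> G p = (F p * x)%g ->
  (forall q, q != p -> G q = F q) ->
  (\prod_(q <- r) G q = (\prod_(q <- r) F q) * x)%g.
Proof.
move=> mulC ur pr Gp GF; case/splitPr: pr ur => r1 r2.
rewrite uniq_catC /= cat_uniq mem_cat negb_or.
move=> /andP[/andP[pr2 pr1] _].
rewrite !big_cat !big_cons /= Gp -!mulgA [(x * _)%g]mulC; congr (_ * (_ * _))%g.
  by apply: eq_big_seq => q qr; apply: GF; apply: contraNneq pr1 => <-.
by congr (_ * _)%g; apply: eq_big_seq => q qr; apply: GF; apply: contraNneq pr2 => <-.
Qed.

Section Inverse.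
Variable n : nat.
Implicit Types (D E F : gauss n) (i j k : 'I_n) (p q : ord_pair n).

Local Notation M := (wSL (crossing_change n)).
Local Notation cl := (wSL_class (crossing_change n)).
Local Notation V := {ffun ord_pair n -> int}.

Definition pair_arrow p b : gauss n := arrow_diagram (val p).1 (val p).2 b.

(** The [z]-th power of the positive arrow of the pair [p]: negative powers are
    powers of the negative arrow, which is its inverse. *)
Definition arrow_power p (z : int) : M :=
  match z with
  | Posz m => (cl (pair_arrow p true) ^+ m)%g
  | Negz m => (cl (pair_arrow p false) ^+ m.+1)%g
  end.

Lemma arrow_power_step p z b :
  arrow_power p (z + sign_val b) = (arrow_power p z * cl (pair_arrow p b))%g.
Proof.
have inv c : (cl (pair_arrow p c) * cl (pair_arrow p (~~ c)) = 1)%g.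
  by apply: cl_opposite_arrow; rewrite neq_ltn (valP p).
case: z b => m [].
- by rewrite -PoszD addn1 /= expgSr.
- case: m => [|m]; first by rewrite add0r /= mul1g.
  rewrite (_ : m.+1%:Z + _ = m) ; last by rewrite -addn1 PoszD addrK.
  by rewrite /= expgSr -mulgA (inv true) mulg1.
- case: m => [|m]; first by rewrite /= (inv false).
  rewrite (_ : Negz m.+1 + _ = Negz m); last first.
    by rewrite !NegzE -addn1 PoszD opprD addrNK.
  by rewrite /= [in RHS]expgSr -mulgA (inv false) mulg1.
- rewrite (_ : Negz m + _ = Negz m.+1); last first.
    by rewrite !NegzE -[m.+2]addn1 PoszD opprD.
  by rewrite /= [LHS]expgSr.
Qed.

Definition arrow_product (v : V) : M := (\prod_p arrow_power p (v p))%g.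

Lemma arrow_product0 : arrow_product 0 = 1%g.
Proof. by rewrite /arrow_product big1 // => p _; rewrite ffunE. Qed.

(** The relations among generators mirror those among their values, which
    reduces the claim to positively oriented pairs [i < j]. *)
Lemma arrow_product_step v i j b :
  arrow_product (v + lk (arrow_diagram i j b)) =
  (arrow_product v * cl (arrow_diagram i j b))%g.
Proof.
have ord (k l : 'I_n) c (kl : (k < l)%N) :
    arrow_product (v + lk (arrow_diagram k l c)) =
    (arrow_product v * cl (arrow_diagram k l c))%g.
  pose p : ord_pair n := exist _ (k, l) kl.
  have lkE q : lk (arrow_diagram k l c) q = if q == p then sign_val c else 0.
    exact: (lk_pair_arrow p q c).
  apply: (@prod_mulr_at _ _ _ _ _ p); first exact: cl_mulC.
  - exact: index_enum_uniq.
  - exact: mem_index_enum.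
  - by rewrite ffunE lkE eqxx arrow_power_step.
  - by move=> q /negbTE qp; rewrite ffunE lkE qp addr0.
have [ij|ji|/val_inj ->] := ltngtP i j; first exact: ord.
  by rewrite lk_reverse_arrow cl_reverse_arrow; apply: ord.
by rewrite lk_self_arrow cl_self_arrow addr0 mulg1.
Qed.

Lemma delete_size D a : a \in arrows D ->
  (size (endpoints (delete D a)) < size (endpoints D))%N.
Proof.
move=> aD.
have -> : size (endpoints (delete D a)) = count (fun e => e.1 != a) (endpoints D).
  rewrite -[LHS]count_predT !count_endpoints; apply: eq_bigr => k _.
  by rewrite ffunE count_predT size_filter; apply: eq_count => e; rewrite inE.
rewrite ltn_neqAle count_size andbT -all_count; apply/allPn.
by exists (tail_of a); rewrite ?negbK //; apply: arrow_endpoints.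
Qed.

(** Completeness of the invariant, by induction on the size of [D]: remove an
    arrow and apply [arrow_product_step]. *)
Lemma cl_arrow_product D : cl D = arrow_product (lk D).
Proof.
have [m] := ubnP (size (endpoints D)); elim: m D => // m IHm D.
rewrite ltnS => Dm; case aD: (arrows D) => [|a r].
  suff -> : D = empty_diagram n by rewrite lk_empty arrow_product0.
  apply: gauss_eq => k; rewrite ffunE; case Dk: (D k) => [|e w] //.
  suff : e.1 \in arrows D by rewrite aD.
  by apply: (@mem_arrows _ _ k); rewrite Dk mem_head.
have {}aD : a \in arrows D by rewrite aD mem_head.
have [i ti] := arrow_strand false aD; have [j hj] := arrow_strand true aD.
have Dd k := delete_split k ti hj.
rewrite (lk_split Dd) arrow_product_step -IHm; last first.
  exact: leq_trans (delete_size aD) Dm.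
by rewrite -cl_stack (cl_rearranged (rearranged_stack Dd)).
Qed.

(** * Classification *)

Lemma lk_w_equiv D E : w_equiv (crossing_change n) D E -> lk D = lk E.
Proof.
elim=> {D E} [D E [/same_rearranged/lk_rearranged|/lk_welded|/lk_CC] | | |] //.
by move=> D E F _ -> _ ->.
Qed.

Definition lk_class (x : M) : V := lk (repr x).

Lemma lk_class_cl D : lk_class (cl D) = lk D.
Proof. by apply: lk_w_equiv; apply/wSL_classP; rewrite /wSL_class reprK. Qed.

Lemma lk_class1 : lk_class 1%g = 0.
Proof. by rewrite -lk_empty -lk_class_cl. Qed.

Lemma lk_classM : {morph lk_class : x y / (x * y)%g >-> x + y}.
Proof.
elim/wSL_ind => D; elim/wSL_ind => E.
by rewrite -cl_stack !lk_class_cl lk_stack.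
Qed.

Lemma lk_class_power p z : lk_class (arrow_power p z) = [ffun q => if q == p then z else 0].
Proof.
have step u b : lk_class (arrow_power p u) = [ffun q => if q == p then u else 0] ->
    lk_class (arrow_power p (u + sign_val b)) =
    [ffun q => if q == p then u + sign_val b else 0].
  move=> IHu; rewrite arrow_power_step lk_classM IHu lk_class_cl.
  by apply/ffunP => q; rewrite [LHS]ffunE [X in X + _]ffunE [RHS]ffunE lk_pair_arrow; case: ifP; rewrite ?addr0.
elim/int_ind: z => [|m IHm|m IHm].
- by rewrite /= lk_class1; apply/ffunP => q; rewrite !ffunE if_same.
- by rewrite -addn1 PoszD; apply: (step _ true).
- by rewrite -addn1 PoszD opprD; apply: (step _ false).
Qed.

Lemma lk_class_product v : lk_class (arrow_product v) = v.
Proof.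
rewrite /arrow_product (big_morph _ lk_classM lk_class1); apply/ffunP => q.
rewrite sum_ffunE (bigD1 q) //= lk_class_power ffunE eqxx big1 ?addr0 // => p pq.
by rewrite lk_class_power ffunE eq_sym (negbTE pq).
Qed.

End Inverse.

Theorem proposition3p8 (n : nat) (hn : (1 <= n)%N) :
  @w_classifies n (crossing_change n) {ffun ord_pair n -> int}
    (fun D => [ffun p : ord_pair n =>
       vlk (val p).1 (val p).2 D - vlk (val p).2 (val p).1 D]).
Proof.
split; [| exact: lk_welded | exact: lk_CC |].
  by move=> D E /same_rearranged; apply: lk_rearranged.
exists (@lk_class n); first exact: lk_class_cl.
split; [| exact: lk_class1 | exact: lk_classM].
exists (@arrow_product n); last exact: lk_class_product.
by elim/wSL_ind => D; rewrite lk_class_cl -cl_arrow_product.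
Qed.
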